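(* Let $R$ be a commutative ring with identity. For a matrix $A=\begin{bmatrix} a & b\\ c & d\end{bmatrix}\in Um(\mathbb{M}_2(R))$ the following statements are equivalent: (1) The matrix $A$ is equivalent to the diagonal matrix $\mathrm{Diag}(1,\det(A))=\begin{bmatrix} 1 & 0\\ 0 & \det(A)\end{bmatrix}$. (2) The matrix $A$ is simply extendable. (3) There exists $(e,f)\in R^2$ such that $(ae+cf,be+df)\in Um(R^2)$ (note that then $(e,f)\in Um(R^2)$). (4) There exists $(x,y,z,w)\in R^4$ such that $ax+by+cz+dw=1$ and the matrix $\begin{bmatrix} x & y\\ z & w\end{bmatrix}$ is non-full.
   Context: $Um(R^n)$ is the set of $n$-tuples in $R^n$ whose entries generate the unit ideal; $Um(\mathbb{M}_2(R))$ is the set of $2\times2$ matrices whose four entries generate the unit ideal. Two matrices $B,C\in\mathbb{M}_2(R)$ are equivalent if $C=MBN$ for some $M,N\in GL_2(R)$. A matrix $A\in\mathbb{M}_2(R)$ is simply extendable if there exists $A^+\in SL_3(R)$ whose upper-left $2\times 2$ block is $A$ and whose $(3,3)$ entry is $0$. A $2\times 2$ matrix over $R$ is non-full if it is the product of a $2\times 1$ matrix and a $1\times 2$ matrix with entries in $R$. *)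

(* Defs.v *)
From HB Require Import structures.
From mathcomp Require Import all_boot all_order all_algebra.
Set Implicit Arguments.
Unset Strict Implicit.
Unset Printing Implicit Defensive.
Import GRing.Theory.
Local Open Scope ring_scope.

(* Rings are [comPzRingType]: commutative with 1, the zero ring included.
   Over such rings [unitmx] is not available, hence [is_GL] below. *)

Definition in_entry_ideal (R : comPzRingType) (m n : nat)
    (A : 'M[R]_(m, n)) (r : R) : Prop :=
  exists C : 'M[R]_(m, n), r = \sum_i \sum_j C i j * A i j.

(* Um(R^n) is the case of row vectors 'rV[R]_n, Um(M_2(R)) that of 'M[R]_2. *)
Definition Um (R : comPzRingType) (m n : nat) (A : 'M[R]_(m, n)) : Prop :=
  forall r : R, in_entry_ideal A r.

Definition is_GL (R : comPzRingType) (n : nat) (M : 'M[R]_n) : Prop :=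
  exists M' : 'M[R]_n, M *m M' = 1%:M /\ M' *m M = 1%:M.

Definition is_SL (R : comPzRingType) (n : nat) (M : 'M[R]_n) : Prop :=
  \det M = 1.

Definition mx_equivalent (R : comPzRingType) (B C : 'M[R]_2) : Prop :=
  exists M N : 'M[R]_2, [/\ is_GL M, is_GL N & C = M *m B *m N].

Definition simply_extendable (R : comPzRingType) (A : 'M[R]_2) : Prop :=
  exists Ap : 'M[R]_(2 + 1),
    [/\ is_SL Ap, ulsubmx Ap = A & Ap ord_max ord_max = 0].

Definition non_full (R : comPzRingType) (B : 'M[R]_2) : Prop :=
  exists (u : 'cV[R]_2) (v : 'rV[R]_2), B = u *m v.

Definition row2 (R : comPzRingType) (e f : R) : 'rV[R]_2 :=
  \row_(j < 2) nth 0 [:: e; f] j.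

Definition mx22 (R : comPzRingType) (a b c d : R) : 'M[R]_2 :=
  \matrix_(i < 2, j < 2) nth 0 (nth [::] [:: [:: a; b]; [:: c; d]] i) j.

(* Main.v *)
Require Import Defs.
From HB Require Import structures.
From mathcomp Require Import all_boot all_order all_algebra.
From mathcomp Require Import ring.
Import GRing.Theory.
Local Open Scope ring_scope.

(** Write [A = mx22 a b c d].  The pivotal condition is the existence of a row
[(e, f)] such that the row [(g, h) = (e, f) *m A] is unimodular, that is,
[g * s + h * t = 1] for some [s] and [t].  Each of the other three conditions
is this one in another guise.

- Equivalence to the diagonal matrix ([equivalent_diagP]).  If [M *m A *m N]
  has upper-left entry [1], the first row of [M] is [(e, f)] and the first
  column of [N] is [(s, t)].  Conversely, put [(p, q) = A *m (s, t)^T], so that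
  [e * p + f * q = 1]; the matrices [mx22 e f (- q) p] and [mx22 s (- h) t g]
  have determinant [1] and bring [A] to the diagonal form.
- Simple extendability ([extendableP]).  By [det_bordered_mx22], the
  determinant of [A] bordered by the column [(- f, e)], the row [(t, - s)] and
  the corner [0] is [g * s + h * t].
- Non-full matrices ([exists_non_fullP]).  A non-full matrix is
  [(e, f)^T *m (s, t)], and its entrywise pairing with [A] is again
  [g * s + h * t]. *)

Lemma mx22_eq (R : comPzRingType) (A : 'M[R]_2) (a b c d : R) :
  A 0 0 = a -> A 0 1 = b -> A 1 0 = c -> A 1 1 = d -> A = mx22 a b c d.
Proof.
move=> Aa Ab Ac Ad; apply/matrixP => i j; rewrite mxE.
case: i j => [[|[|//]] ilt] [[|[|//]] jlt] /=;
  [rewrite -Aa|rewrite -Ab|rewrite -Ac|rewrite -Ad];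
  congr (A _ _); exact: val_inj.
Qed.

Lemma mul_mx22 (R : comPzRingType) (a b c d x y z w : R) :
  mx22 a b c d *m mx22 x y z w =
  mx22 (a * x + b * z) (a * y + b * w) (c * x + d * z) (c * y + d * w).
Proof. by apply: mx22_eq; rewrite !mxE big_ord_recl big_ord1 !mxE. Qed.

Lemma det_mx22 (R : comPzRingType) (a b c d : R) :
  \det (mx22 a b c d) = a * d - b * c.
Proof.
rewrite (expand_det_row _ 0) big_ord_recl big_ord1 /cofactor !det_mx11 !mxE /=.
ring.
Qed.

(** The inverse is the adjugate matrix. *)
Lemma is_GL_det1 (R : comPzRingType) (a b c d : R) :
  a * d - b * c = 1 -> is_GL (mx22 a b c d).
Proof.
move=> det1; exists (mx22 d (- b) (- c) a).
by split; rewrite mul_mx22; apply/esym/mx22_eq; rewrite !mxE /= -?det1; ring.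
Qed.

(** The right-hand side is minus [v] times the adjugate of [mx22 a b c d] times
[u]; it is obtained by expanding along the last row. *)
Lemma det_bordered_mx22 (R : comPzRingType) (a b c d : R)
    (u : 'cV[R]_2) (v : 'rV[R]_2) :
  \det (block_mx (mx22 a b c d) u v 0) =
  v 0 0 * (b * u 1 0 - d * u 0 0) + v 0 1 * (c * u 0 0 - a * u 1 0).
Proof.
have Bul i j :
    block_mx (mx22 a b c d) u v 0 (lshift 1 i) (lshift 1 j) = mx22 a b c d i j.
  exact: block_mxEul.
have Bur i : block_mx (mx22 a b c d) u v 0 (lshift 1 i) (rshift 2 0) = u i 0.
  exact: block_mxEur.
(* Indices that survive the deletion of the last row and of column 0 or 1. *)
have low0 : lift (rshift 2 (0 : 'I_1)) 0 = lshift 1 (0 : 'I_2) by exact: val_inj.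
have low1 : lift (rshift 2 (0 : 'I_1)) 1 = lshift 1 (1 : 'I_2) by exact: val_inj.
have l00 : lift (lshift 1 (0 : 'I_2)) 0 = lshift 1 (1 : 'I_2) by exact: val_inj.
have l01 : lift (lshift 1 (0 : 'I_2)) 1 = rshift 2 (0 : 'I_1) by exact: val_inj.
have l10 : lift (lshift 1 (1 : 'I_2)) 0 = lshift 1 (0 : 'I_2) by exact: val_inj.
have l11 : lift (lshift 1 (1 : 'I_2)) 1 = rshift 2 (0 : 'I_1) by exact: val_inj.
rewrite (expand_det_row _ (rshift 2 0)) big_split_ord /= big_ord_recl !big_ord1.
rewrite !block_mxEdl block_mxEdr mxE mul0r addr0 /cofactor.
have -> : lift ord0 ord0 = 1 :> 'I_2 by exact: val_inj.
have -> : ord0 = 0 :> 'I_2 by [].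
rewrite [row' _ (col' (lshift 1 0) _)](_ : _ =
    mx22 b (u 0 0) d (u 1 0)); last first.
  by apply: mx22_eq; rewrite 2!mxE ?low0 ?low1 ?l00 ?l01 ?Bul ?Bur ?mxE.
rewrite [row' _ (col' (lshift 1 1) _)](_ : _ =
    mx22 a (u 0 0) c (u 1 0)); last first.
  by apply: mx22_eq; rewrite 2!mxE ?low0 ?low1 ?l10 ?l11 ?Bul ?Bur ?mxE.
rewrite !det_mx22 /=.
ring.
Qed.

Lemma Um_row2P (R : comPzRingType) (g h : R) :
  Um (row2 g h) <-> exists s t : R, g * s + h * t = 1.
Proof.
split=> [/(_ 1) [C] | [s [t gsht1]] r].
  rewrite big_ord1 big_ord_recl big_ord1 !mxE /= => ->.
  by exists (C ord0 ord0), (C ord0 (lift ord0 ord0)); rewrite mulrC [h * _]mulrC.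
exists (row2 (r * s) (r * t)).
rewrite big_ord1 big_ord_recl big_ord1 !mxE /=.
by rewrite -[LHS]mulr1 -gsht1; ring.
Qed.

(** The last column [(u 0 0, u 1 0)] of an extension gives [(e, f)] by a quarter
turn: [e = u 1 0] and [f = - u 0 0]. *)
Lemma extendableP (R : comPzRingType) (a b c d : R) :
  simply_extendable (mx22 a b c d) <->
  exists e f : R, Um (row2 (a * e + c * f) (b * e + d * f)).
Proof.
split=> [[Ap [detAp ulAp lr0]] | [e [f /Um_row2P [s [t gsht1]]]]].
  have dr0 : drsubmx Ap = 0.
    apply/matrixP=> i j; rewrite !ord1 !mxE -[RHS]lr0.
    by congr (Ap _ _); exact: val_inj.
  move: detAp; rewrite /is_SL -(submxK Ap) ulAp dr0 det_bordered_mx22.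
  set u := ursubmx Ap; set v := dlsubmx Ap => det1.
  exists (u 1 0), (- u 0 0); apply/Um_row2P; exists (- v 0 1), (v 0 0).
  by rewrite -det1; ring.
exists (block_mx (mx22 a b c d) (row2 (- f) e)^T (row2 t (- s)) 0).
split; first 1 last.
- exact: block_mxKul.
- rewrite (_ : ord_max = rshift 2 (0 : 'I_1)); last exact: val_inj.
  by rewrite block_mxEdr mxE.
by rewrite /is_SL det_bordered_mx22 !mxE /= -gsht1; ring.
Qed.

Lemma Um_row2_combination (R : comPzRingType) (a b c d e f : R) :
  Um (row2 (a * e + c * f) (b * e + d * f)) -> Um (row2 e f).
Proof.
move=> /Um_row2P [s [t gsht1]]; apply/Um_row2P.
by exists (a * s + b * t), (c * s + d * t); rewrite -gsht1; ring.
Qed.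

Lemma non_fullP (R : comPzRingType) (x y z w : R) :
  non_full (mx22 x y z w) <->
  exists e f s t : R, [/\ x = e * s, y = e * t, z = f * s & w = f * t].
Proof.
split=> [[u [v /matrixP uv]] | [e [f [s [t [-> -> -> ->]]]]]].
  exists (u 0 0), (u 1 0), (v 0 0), (v 0 1).
  by split; [have := uv 0 0 | have := uv 0 1 | have := uv 1 0 | have := uv 1 1];
    rewrite !mxE big_ord1.
exists (row2 e f)^T, (row2 s t).
by apply/esym/mx22_eq; rewrite !mxE big_ord1 !mxE.
Qed.

Lemma exists_non_fullP (R : comPzRingType) (a b c d : R) :
  (exists e f : R, Um (row2 (a * e + c * f) (b * e + d * f))) <->
  (exists x y z w : R,
     a * x + b * y + c * z + d * w = 1 /\ non_full (mx22 x y z w)).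
Proof.
split=> [[e [f /Um_row2P [s [t gsht1]]]] | [x [y [z [w [axdw1]]]]]].
  exists (e * s), (e * t), (f * s), (f * t).
  by split; [rewrite -gsht1; ring | apply/non_fullP; exists e, f, s, t].
move=> /non_fullP [e [f [s [t [xE yE zE wE]]]]].
exists e, f; apply/Um_row2P; exists s, t.
by rewrite -axdw1 xE yE zE wE; ring.
Qed.

(** The direct implication compares the upper-left entries of both sides; the
converse gives explicit matrices of determinant [1]. *)
Lemma equivalent_diagP (R : comPzRingType) (a b c d : R) :
  mx_equivalent (mx22 a b c d) (diag_mx (row2 1 (\det (mx22 a b c d)))) <->
  exists e f : R, Um (row2 (a * e + c * f) (b * e + d * f)).
Proof.
split=> [[M [N [_ _ /matrixP D]]] | [e [f /Um_row2P [s [t gsht1]]]]].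
  exists (M 0 0), (M 0 1); apply/Um_row2P; exists (N 0 0), (N 1 0).
  have := D 0 0.
  rewrite (mx22_eq _ M _ _ _ _ erefl erefl erefl erefl).
  rewrite (mx22_eq _ N _ _ _ _ erefl erefl erefl erefl).
  by rewrite !mul_mx22 !mxE /= => D00; apply: etrans (esym D00); ring.
exists (mx22 e f (- (c * s + d * t)) (a * s + b * t)),
       (mx22 s (- (b * e + d * f)) t (a * e + c * f)).
split; try by apply: is_GL_det1; rewrite -gsht1; ring.
rewrite !mul_mx22 det_mx22; apply: mx22_eq; rewrite !mxE /=.
- by rewrite mulr1n -gsht1; ring.
- by ring.
- by ring.
- by rewrite mulr1n -[LHS]mulr1 -gsht1; ring.
Qed.

Theorem theorem4p3 (R : comPzRingType) (a b c d : R)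
    (hA : Um (mx22 a b c d)) :
  [<-> mx_equivalent (mx22 a b c d) (diag_mx (row2 1 (\det (mx22 a b c d))));
       simply_extendable (mx22 a b c d);
       exists e f : R, Um (row2 (a * e + c * f) (b * e + d * f));
       exists x y z w : R,
         a * x + b * y + c * z + d * w = 1 /\ non_full (mx22 x y z w)]
  /\ (forall e f : R,
        Um (row2 (a * e + c * f) (b * e + d * f)) -> Um (row2 e f)).
Proof.
split; last exact: Um_row2_combination.
tfae.
- by move=> /equivalent_diagP /extendableP.
- by move=> /extendableP.
- by move=> /exists_non_fullP.
- by move=> /exists_non_fullP /equivalent_diagP.
Qed.
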